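(* There is an absolute constant $C>0$ such that the following holds. Let $n\ge 1$ and let $P_1,\ldots,P_m$ be mutually commuting $n$-Pauli operators whose tableau $[X,Z]\in\mathbb{F}_2^{m\times 2n}$ has rank $n$ over $\mathbb{F}_2$. Then $P_1,\ldots,P_m$ can be simultaneously diagonalized by a circuit with stages H-S-CX-S-H containing $\mathcal{O}(n^2)$ CX gates. That is, there is a unitary $\mathcal{U}=U_5U_4U_3U_2U_1$ on $n$ qubits, where $U_1$ is a product of Hadamard gates, $U_2$ is a product of phase gates $S$, $U_3$ is a product of at most $Cn^2$ CX (controlled-NOT) gates, $U_4$ is a product of phase gates $S$, and $U_5$ is a product of Hadamard gates (each acting on some of the $n$ qubits, with empty products allowed), such that for every $j\in\{1,\ldots,m\}$ the operator $\mathcal{U}P_j\mathcal{U}^\dagger$ is, up to a sign $\pm1$, a tensor product of $n$ matrices from $\{\sigma_i,\sigma_z\}$ (and hence diagonal).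
   Context: An $n$-Pauli operator is, up to a sign $\pm1$, a tensor product of $n$ matrices from $\{\sigma_i,\sigma_x,\sigma_y,\sigma_z\}$, where $\sigma_i$ is the $2\times 2$ identity and $\sigma_x,\sigma_y,\sigma_z$ are the Pauli matrices. Tableau: the list $P_1,\ldots,P_m$ is represented by binary matrices $X,Z\in\mathbb{F}_2^{m\times n}$ (together with a sign vector). The pair $(X_{i,j},Z_{i,j})$ encodes the $j$th tensor factor of $P_i$: $(0,0)$ for $\sigma_i$, $(1,0)$ for $\sigma_x$, $(0,1)$ for $\sigma_z$, $(1,1)$ for $\sigma_y$. The rank of the tableau is the rank of $[X,Z]$ over $\mathbb{F}_2$. Gates: the Hadamard gate is $H=\frac{1}{\sqrt2}\begin{pmatrix}1&1\\1&-1\end{pmatrix}$, the phase gate is $S=\begin{pmatrix}1&0\\0&i\end{pmatrix}$, both acting on one qubit, and $CX(a,b)$ (also called CNOT) is the two-qubit gate that negates qubit $b$ conditional on qubit $a$, for distinct qubits $a,b$; i.e. on computational basis states $|u\rangle_a|v\rangle_b\mapsto|u\rangle_a|u\oplus v\rangle_b$. Stages are listed in the order in which they are applied. *)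

(* Defs.v *)
From HB Require Import structures.
From mathcomp Require Import all_boot all_order all_fingroup all_algebra.

Set Implicit Arguments.
Unset Strict Implicit.
Unset Printing Implicit Defensive.

Import GRing.Theory Num.Theory.
Local Open Scope ring_scope.

(* Computational basis states of n qubits: bit strings. *)
Definition basis (n : nat) := {ffun 'I_n -> 'I_2}.

Section Operators.
Variable C : numClosedFieldType.

(* Operators on (C^2)^{(x) n}: rows and columns are numbered by the finType
   enumeration of the 2^n basis states (enum_val / enum_rank). *)
Definition qop (n : nat) := 'M[C]_#|{: basis n}|.

(* <y| M |x> = f y x. *)
Definition qop_of n (f : basis n -> basis n -> C) : qop n :=
  \matrix_(i, j) f (enum_val i) (enum_val j).

(* A_0 (x) ... (x) A_{n-1}, entrywise.  An n-fold iteration of the binary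
   Kronecker product mxtens.tensmx would need dimension casts. *)
Definition tensor n (A : 'I_n -> 'M[C]_2) : qop n :=
  qop_of (fun y x => \prod_k A k (y k) (x k)).

Definition mx2 (a b c d : C) : 'M[C]_2 :=
  \matrix_(i, j) if i == 0 then (if j == 0 then a else b)
                 else (if j == 0 then c else d).

Definition sigma_i : 'M[C]_2 := mx2 1 0 0 1.
Definition sigma_x : 'M[C]_2 := mx2 0 1 1 0.
Definition sigma_y : 'M[C]_2 := mx2 0 (- 'i) 'i 0.
Definition sigma_z : 'M[C]_2 := mx2 1 0 0 (-1).

Definition signed_tensor_of (S : seq 'M[C]_2) n (M : qop n) : Prop :=
  exists (b : bool) (A : 'I_n -> 'M[C]_2),
    (forall k, A k \in S) /\ M = (-1) ^+ b *: tensor A.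

Definition is_pauli n (M : qop n) : Prop :=
  signed_tensor_of [:: sigma_i; sigma_x; sigma_y; sigma_z] M.

Definition pauli_of_bits (x z : 'F_2) : 'M[C]_2 :=
  if x == 0 then (if z == 0 then sigma_i else sigma_z)
  else (if z == 0 then sigma_x else sigma_y).

(* r is the sign vector: the sign of P i is -1 iff r i = true. *)
Definition is_tableau m n (P : 'I_m -> qop n)
    (X Z : 'M['F_2]_(m, n)) (r : 'I_m -> bool) : Prop :=
  forall i, P i = (-1) ^+ r i *:
                  tensor (fun j => pauli_of_bits (X i j) (Z i j)).

Definition hadamard : 'M[C]_2 := (sqrtC 2)^-1 *: mx2 1 1 1 (-1).
Definition phase : 'M[C]_2 := mx2 1 0 0 'i.

Definition gate1 n (A : 'M[C]_2) (a : 'I_n) : qop n :=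
  tensor (fun k => if k == a then A else 1%:M).

(* Addition in 'I_2 is exclusive or. *)
Definition cx_basis n (a b : 'I_n) (x : basis n) : basis n :=
  [ffun k => if k == b then x a + x b else x k].

Definition CX n (a b : 'I_n) : qop n :=
  qop_of (fun y x => (y == cx_basis a b x)%:R).

Definition is_H_stage n (U : qop n) : Prop :=
  exists s : seq 'I_n, U = \big[mulmx/1%:M]_(a <- s) gate1 hadamard a.

Definition is_S_stage n (U : qop n) : Prop :=
  exists s : seq 'I_n, U = \big[mulmx/1%:M]_(a <- s) gate1 phase a.

(* U is a product of at most k CX gates. *)
Definition is_CX_stage n (k : nat) (U : qop n) : Prop :=
  exists s : seq ('I_n * 'I_n),
    [/\ all (fun p => p.1 != p.2) s, (size s <= k)%N
      & U = \big[mulmx/1%:M]_(p <- s) CX p.1 p.2].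

End Operators.

(* Main.v *)
Require Import Defs.
From HB Require Import structures.
From mathcomp Require Import all_boot all_order all_fingroup all_algebra.
From mathcomp Require Import ring.

Set Implicit Arguments.
Unset Strict Implicit.
Unset Printing Implicit Defensive.

Import GRing.Theory Num.Theory.
Local Open Scope ring_scope.
Local Open Scope sesquilinear_scope.

(* Row-space coordinates: conjugation by H on qubit k swaps columns k of X and
   Z, conjugation by S adds column k of X to column k of Z, and a CX circuit
   maps (x, z M^T) to (x M, z).

   Choose columns of X forming a basis of its column space and swap all the
   others: because the tableau is Lagrangian, the new X has rank n, so the new
   tableau is the graph Z = X A of a matrix A, and A is symmetric.  Greedy
   elimination gives a diagonal D and a lower unitriangular L with
   A + D = L L^T.  Phase gates on D turn A into A + D, a CX circuit for L (at
   most one gate per entry) turns (x, x L L^T) into (x L, x L), and phase gates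
   followed by Hadamard gates on all qubits turn this into (x L, 0) and then
   (0, x L). *)

(** * Gram factorization of symmetric matrices up to the diagonal *)

(** Elimination by induction on the size: the free diagonal [d] sets each pivot to 1, so neither
    division nor square roots occur and any commutative ring will do. With [u] the rest of the first
    row, the first column of [L] is 1 followed by [u^T], and the induction continues on the Schur
    complement, which is again symmetric. *)
Lemma unitriangular_gram_add_diag (R : comNzRingType) n (A : 'M[R]_n) :
  A^T = A ->
  exists (d : 'rV[R]_n) (L : 'M[R]_n),
    [/\ is_trig_mx L, forall i, L i i = 1 & A + diag_mx d = L *m L^T].
Proof.
elim: n A => [|n IHn].
  exists 0, 1%:M; split=> [|[]//|]; last by apply/matrixP => -[].
  exact: scalar_mx_is_trig.
rewrite -[n.+1]/(1 + n)%N => A symA.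
have [|d' [L' [trigL' diagL' eqL']]] :=
    IHn (drsubmx A - (ursubmx A)^T *m ursubmx A).
  by rewrite linearB /= trmx_mul trmxK trmx_drsub symA.
exists (row_mx (1 - ulsubmx A) d'), (block_mx 1%:M 0 (ursubmx A)^T L'); split.
- by rewrite is_trig_block_mx // eqxx scalar_mx_is_trig.
- move=> i; case: (split_ordP i) => j ->; rewrite ?block_mxEdr ?diagL' //.
  by rewrite block_mxEul ord1 mxE.
rewrite -{1}[A]submxK diag_mx_row add_block_mx tr_block_mx mulmx_block.
rewrite trmx1 trmx0 trmxK !mul1mx !mul0mx !mulmx0 !mulmx1 !addr0.
congr block_mx.
- apply/matrixP => i j; rewrite !ord1 !mxE eqxx.
  by rewrite mulr1n subrKC.
- by rewrite trmx_ursub symA.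
- by rewrite -eqL' addrA subrKC.
Qed.

(** * Column swaps that keep the rank *)

(** [swap_on S X Z] and [swap_on S Z X] are the two halves of the tableau after Hadamard gates on
    the qubits in [S]. *)
Definition swap_on (T : Type) m n (S : {set 'I_n}) (X Z : 'M[T]_(m, n)) :
    'M[T]_(m, n) :=
  \matrix_(i, j) if j \in S then Z i j else X i j.

Lemma mul_swap_on (R : pzSemiRingType) p m n (S : {set 'I_n})
    (A : 'M[R]_(p, m)) (X Z : 'M[R]_(m, n)) :
  A *m swap_on S X Z = swap_on S (A *m X) (A *m Z).
Proof.
apply/matrixP => i j; rewrite !mxE.
by case: ifP => jS; apply: eq_bigr => k _; rewrite mxE jS.
Qed.

(* X Z^T = Z X^T makes a Z orthogonal to the rows of X whenever a X = 0. *)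
Lemma swap_on_full_rank (F : fieldType) m n (X Z : 'M[F]_(m, n)) :
  X *m Z^T = Z *m X^T ->
  exists S : {set 'I_n}, forall a : 'rV[F]_m,
    a *m swap_on S X Z = 0 -> a *m X = 0 /\ a *m Z = 0.
Proof.
(* [f] selects columns of [X] that form a basis of its column space; [S] consists of all the
   others. *)
move=> isoXZ; pose f := maxrankfun X^T.
pose S := [set j | j \notin codom f]; exists S => a aXZ0.
have swapE j : (a *m swap_on S X Z) 0 j
    = if j \in S then (a *m Z) 0 j else (a *m X) 0 j.
  by rewrite mul_swap_on mxE.
have fS k : (f k \in S) = false by rewrite inE codom_f.
have aX0 : a *m X = 0.
  have /submxP[N XN] : (X^T <= rowsub f X^T)%MS by rewrite eq_maxrowsub.
  apply: trmx_inj; rewrite trmx_mul XN trmx0 -mulmxA.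
  suff -> : rowsub f X^T *m a^T = 0 by rewrite mulmx0.
  apply/matrixP => k j; rewrite ord1.
  have aXf0 : (a *m X) 0 (f k) = 0.
    by have := swapE (f k); rewrite fS aXZ0 => <-; rewrite mxE.
  rewrite [RHS]mxE -aXf0 !mxE; apply: eq_bigr => i _.
  by rewrite !mxE mulrC.
have aZS j : j \in S -> (a *m Z) 0 j = 0.
  by move=> jS; have := swapE j; rewrite jS aXZ0 => <-; rewrite mxE.
split=> //; apply/rowP => j; rewrite [RHS]mxE.
have [/aZS//|] := boolP (j \in S); rewrite inE negbK => /codomP[k ->].
(* The selected columns are independent, so some [N] makes the rows [f l] of [X^T *m N] an identity
   matrix. As [a *m Z] vanishes on [S], column [k] of the zero product [a *m Z *m (X^T *m N)] is
   just the entry of [a *m Z] at [f k]. *)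
have /row_freeP[N XN] := maxrowsub_free X^T.
have aZXN : a *m Z *m (X^T *m N) = 0.
  by rewrite mulmxA -(mulmxA a) -isoXZ mulmxA aX0 !mul0mx.
have XNE l : (X^T *m N) (f l) k = (l == k)%:R.
  have := congr1 (fun M : 'M_(_, _) => M l k) XN.
  by rewrite [RHS]mxE => <-; rewrite !mxE; apply: eq_bigr => j' _; rewrite !mxE.
have := congr1 (fun M : 'rV_(_) => M 0 k) aZXN.
rewrite mxE (bigD1 (f k)) //= XNE eqxx mulr1 [in RHS]mxE big1 ?addr0 // => l.
have [/aZS -> _|] := boolP (l \in S).
  exact: mul0r.
rewrite inE negbK => /codomP[l' ->] neq.
have lk : (l' == k) = false by apply: contraNF neq => /eqP->.
by rewrite XNE lk mulr0.
Qed.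

(** * Signs and parities over ['F_2] *)

Lemma F2P (x : 'F_2) : x = 0 \/ x = 1.
Proof. by case: x => -[|[|]] // ?; [left | right]; apply: val_inj. Qed.

Lemma addF2_eq0 (V : lmodType 'F_2) (u v : V) : (u + v == 0) = (u == v).
Proof.
have vv : v + v = 0.
  by rewrite -[v]scale1r -scalerDl (_ : 1 + 1 = 0) ?scale0r //; apply: val_inj.
have nv : - v = v by apply/eqP; rewrite eq_sym -addr_eq0 vv.
by rewrite addr_eq0 nv.
Qed.

(** The left sum is in [nat], the right one in ['F_2]: this turns exponents of phases into inner
    products of bit vectors. *)
Lemma odd_sum_F2 n (e : 'I_n -> 'F_2) :
  odd (\sum_k e k)%N = odd (\sum_k e k)%R.
Proof.
apply: (big_rec2 (fun (x : nat) (y : 'F_2) => odd x = odd y)) => // k x y _ IH.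
rewrite oddD IH.
by have [->|->] := F2P (e k); have [->|->] := F2P y.
Qed.

Lemma prod_signr_F2 (R : comNzRingType) n (e : 'I_n -> 'F_2) :
  \prod_k (-1) ^+ e k = (-1) ^+ (\sum_k e k)%R :> R.
Proof. by rewrite prodrXr -signr_odd odd_sum_F2 signr_odd. Qed.

(** * Lagrangian tableaux as graphs of symmetric matrices *)

(** Column swaps preserve the symplectic form: at a swapped index its two terms trade places. *)
Lemma mul_swap_on_tr m n (S : {set 'I_n}) (X Z : 'M['F_2]_(m, n)) :
  swap_on S X Z *m (swap_on S Z X)^T + swap_on S Z X *m (swap_on S X Z)^T
  = X *m Z^T + Z *m X^T.
Proof.
apply/matrixP => i j; rewrite !mxE -!big_split; apply: eq_bigr => k _.
by rewrite !mxE; case: ifP => // _; apply: addrC.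
Qed.

Lemma row_swap_on T m n (S : {set 'I_n}) (X Z : 'M[T]_(m, n)) i :
  row i (swap_on S X Z) = swap_on S (row i X) (row i Z).
Proof. by apply/rowP => k; rewrite !mxE; case: ifP. Qed.

Lemma lagrangian_graph m n (X Z : 'M['F_2]_(m, n)) :
  X *m Z^T + Z *m X^T = 0 -> \rank (row_mx X Z) = n ->
  exists (S : {set 'I_n}) (A : 'M['F_2]_n),
    A^T = A /\ swap_on S Z X = swap_on S X Z *m A.
Proof.
move=> isoXZ rankXZ; have eqXZ : X *m Z^T = Z *m X^T.
  by apply/eqP; rewrite -addF2_eq0 isoXZ.
have [S inj_swap] := swap_on_full_rank eqXZ; exists S.
set X1 := swap_on S X Z; set Z1 := swap_on S Z X.
have kerX1 (k : nat) (A : 'M_(k, m)) : A *m X1 = 0 -> A *m X = 0 /\ A *m Z = 0.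
  move=> AX1; suff rowA i : row i A *m X = 0 /\ row i A *m Z = 0.
    by split; apply/row_matrixP => i; rewrite row_mul row0; case: (rowA i).
  by apply: inj_swap; rewrite -row_mul AX1 row0.
have kerXZ : (kermx X1 <= kermx (row_mx X Z))%MS.
  have [kerX kerZ] := kerX1 _ _ (mulmx_ker X1).
  by apply/sub_kermxP; rewrite mul_mx_row kerX kerZ row_mx0.
(* Comparing kernels, the rank of [X1] is at least that of [row_mx X Z], hence [n]; so [X1] has a
   left inverse [B]. *)
have /row_fullP[B BX1] : row_full X1.
  rewrite /row_full eqn_leq rank_leq_col -{1}rankXZ.
  rewrite -(subKn (rank_leq_row (row_mx X Z))) -(subKn (rank_leq_row X1)).
  by rewrite leq_sub2l // -!mxrank_ker mxrankS.
exists (B *m Z1); split.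
  (* This form shows the symmetry, since [Z1 *m X1^T] is symmetric by isotropy. *)
  have -> : B *m Z1 = B *m (Z1 *m X1^T) *m B^T.
    by rewrite -!mulmxA -trmx_mul BX1 trmx1 mulmx1.
  have /eqP := mul_swap_on_tr S X Z.
  rewrite isoXZ addF2_eq0 -/X1 -/Z1 => /eqP isoX1.
  by rewrite !trmx_mul !trmxK isoX1 !mulmxA.
(* [1 - X1 B] annihilates [X1], hence [X] and [Z], hence also [Z1], which gives [Z1 = X1 B Z1]. *)
have [X0 Z0] : (1%:M - X1 *m B) *m X = 0 /\ (1%:M - X1 *m B) *m Z = 0.
  by apply: kerX1; rewrite mulmxBl mul1mx -mulmxA BX1 mulmx1 subrr.
apply/eqP; rewrite mulmxA -subr_eq0 -{1}[Z1]mul1mx -mulmxBl mul_swap_on X0 Z0.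
by apply/eqP/matrixP => i j; rewrite !mxE if_same.
Qed.

Lemma neq_ffun (I : finType) (T : eqType) (y x : {ffun I -> T}) :
  y != x -> exists k, y k != x k.
Proof.
move=> neq; apply/existsP; rewrite -negb_forall; apply: contraNN neq.
by move=> /forallP yx; apply/eqP/ffunP => k; apply/eqP.
Qed.

(** * Operators as kernels on basis states, and tensor products *)

Section LocalCliffords.
Variable C : numClosedFieldType.

Section QubitRegister.
Variable n : nat.
Implicit Types (f g : basis n -> basis n -> C) (A B : 'I_n -> 'M[C]_2).

Lemma eq_qop_of f g : f =2 g -> qop_of f = qop_of g.
Proof. by move=> fg; apply/matrixP => i j; rewrite !mxE fg. Qed.

Lemma qop_of_mul f g :
  qop_of f *m qop_of g = qop_of (fun y x => \sum_w f y w * g w x).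
Proof.
apply/matrixP => i j; rewrite !mxE (reindex (@enum_rank _)) /=.
  by apply: eq_bigr => w _; rewrite !mxE enum_rankK.
exact/onW_bij/enum_rank_bij.
Qed.

Lemma qop_of_adj f : (qop_of f)^t* = qop_of (fun y x => (f x y)^*).
Proof. by apply/matrixP => i j; rewrite !mxE. Qed.

Lemma qop_of_scale c f : c *: qop_of f = qop_of (fun y x => c * f y x).
Proof. by apply/matrixP => i j; rewrite !mxE. Qed.

Lemma qop_of_id : qop_of (fun y x : basis n => (y == x)%:R) = 1%:M :> qop C n.
Proof. by apply/matrixP => i j; rewrite !mxE (inj_eq enum_val_inj). Qed.

Lemma eq_tensor A B : A =1 B -> tensor A = tensor B.
Proof.
by move=> AB; apply: eq_qop_of => y x; apply: eq_bigr => k _; rewrite AB.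
Qed.

Lemma tensor_mul A B : tensor A *m tensor B = tensor (fun k => A k *m B k).
Proof.
rewrite qop_of_mul; apply: eq_qop_of => y x.
under [RHS]eq_bigr do rewrite mxE.
by rewrite bigA_distr_bigA; apply: eq_bigr => w _; rewrite -big_split.
Qed.

Lemma tensor_adj A : (tensor A)^t* = tensor (fun k => (A k)^t*).
Proof.
rewrite qop_of_adj; apply: eq_qop_of => y x.
by rewrite rmorph_prod; apply: eq_bigr => k _; rewrite !mxE.
Qed.

Lemma tensor_scale (c : 'I_n -> C) A :
  tensor (fun k => c k *: A k) = (\prod_k c k) *: tensor A.
Proof.
rewrite qop_of_scale; apply: eq_qop_of => y x.
by rewrite -big_split; apply: eq_bigr => k _; rewrite mxE.
Qed.

Lemma prod_eq_ffun (T : eqType) (y x : {ffun 'I_n -> T}) :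
  \prod_k (y k == x k)%:R = (y == x)%:R :> C.
Proof.
have [->|/neq_ffun[k neqk]] := eqVneq y x.
  by rewrite big1 // => k _; rewrite eqxx.
by rewrite (bigD1 k) //= (negbTE neqk) mul0r.
Qed.

Lemma tensor_id : tensor (fun=> 1%:M) = 1%:M :> qop C n.
Proof.
rewrite -qop_of_id; apply: eq_qop_of => y x; rewrite -prod_eq_ffun.
by apply: eq_bigr => k _; rewrite mxE.
Qed.

Lemma tensor_unitary A :
  (forall k, A k \is unitarymx) -> tensor A \is unitarymx.
Proof.
move=> uA; apply/unitarymxP; rewrite tensor_adj tensor_mul -tensor_id.
by apply: eq_tensor => k; apply/unitarymxP.
Qed.

Lemma gate1_stage (A : 'M[C]_2) (s : seq 'I_n) : uniq s ->
  \big[mulmx/1%:M]_(a <- s) gate1 A a =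
  tensor (fun k => if k \in s then A else 1%:M).
Proof.
elim: s => [|a s IHs] /=; first by rewrite big_nil -tensor_id.
case/andP=> aNs /IHs IH; rewrite big_cons IH tensor_mul.
apply: eq_tensor => k; rewrite inE; case: eqP => [->|_]; last by rewrite mul1mx.
by rewrite (negbTE aNs) mulmx1.
Qed.

End QubitRegister.

(** * Conjugation of Pauli operators by one-qubit gates *)

Definition pauli_row n (x z : 'rV['F_2]_n) : qop C n :=
  tensor (fun k => pauli_of_bits C (x 0 k) (z 0 k)).

(** The sign stays existential: the conclusion is up to sign, so only the bit vectors need tracking
    through the circuit. *)
Definition conj_pauli n (U : qop C n) (x z x' z' : 'rV['F_2]_n) : Prop :=
  exists b : bool,
    U *m pauli_row x z *m U^t* = (-1) ^+ b *: pauli_row x' z'.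

Lemma conj_pauli_mul n (U V : qop C n) x z x' z' x'' z'' :
  conj_pauli V x z x' z' -> conj_pauli U x' z' x'' z'' ->
  conj_pauli (U *m V) x z x'' z''.
Proof.
move=> [b eqV] [c eqU]; exists (b (+) c).
rewrite trmx_mul map_mxM !mulmxA -[U *m V *m _]mulmxA.
by rewrite -[_ *m _ *m V^t*]mulmxA eqV -scalemxAr -scalemxAl
  eqU scalerA signr_addb.
Qed.

Lemma signr_prod n (b : 'I_n -> bool) :
  exists c : bool, \prod_k (-1) ^+ b k = (-1) ^+ c :> C.
Proof.
by exists (odd (\sum_k b k)); rewrite signr_odd prodrXr.
Qed.

Lemma tensor_conj_pauli n (A : 'I_n -> 'M[C]_2) (x z x' z' : 'rV_n) :
  (forall k, exists b : bool,
     A k *m pauli_of_bits C (x 0 k) (z 0 k) *m (A k)^t*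
     = (-1) ^+ b *: pauli_of_bits C (x' 0 k) (z' 0 k)) ->
  conj_pauli (tensor A) x z x' z'.
Proof.
case/fin_all_exists => b eqA; have [c bc] := signr_prod b; exists c.
rewrite -bc -tensor_scale tensor_adj !tensor_mul.
exact: eq_tensor.
Qed.

Lemma mx2P (A B : 'M[C]_2) :
  A 0 0 = B 0 0 -> A 0 1 = B 0 1 -> A 1 0 = B 1 0 -> A 1 1 = B 1 1 -> A = B.
Proof.
move=> A00 A01 A10 A11; apply/matrixP => i j.
(* ['F_2] computes to ['I_2], so [F2P] also splits on matrix indices. *)
by have [->|->] := F2P i; have [->|->] := F2P j.
Qed.

Lemma mx2_mul (a b c d a' b' c' d' : C) :
  mx2 a b c d *m mx2 a' b' c' d' =
  mx2 (a * a' + b * c') (a * b' + b * d') (c * a' + d * c') (c * b' + d * d').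
Proof. by apply: mx2P; rewrite !mxE big_ord_recl big_ord1 !mxE. Qed.

Lemma mx2_adj (a b c d : C) : (mx2 a b c d)^t* = mx2 a^* c^* b^* d^*.
Proof. by apply: mx2P; rewrite !mxE. Qed.

Lemma mx2_scale (e a b c d : C) :
  e *: mx2 a b c d = mx2 (e * a) (e * b) (e * c) (e * d).
Proof. by apply: mx2P; rewrite !mxE. Qed.

Lemma mx2_id : 1%:M = mx2 1 0 0 1 :> 'M[C]_2.
Proof. by apply: mx2P; rewrite !mxE. Qed.

Lemma phase_unitary : phase C \is unitarymx.
Proof.
apply/unitarymxP; rewrite mx2_adj mx2_mul mx2_id.
by rewrite conjC0 conjC1 conjCi; congr mx2; ring: (sqrCi C).
Qed.

Lemma phase_conj x z :
  phase C *m pauli_of_bits C x z *m (phase C)^t*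
  = (-1) ^+ ((x == 1) && (z == 1)) *: pauli_of_bits C x (z + x).
Proof.
have [->|->] := F2P x; have [->|->] := F2P z;
  rewrite /pauli_of_bits /= !(mx2_adj, mx2_mul, mx2_scale);
  by rewrite conjC0 conjC1 conjCi; congr mx2; ring: (sqrCi C).
Qed.

(** The two factors [1/sqrt 2] merge into [1/2], because the root is real; later uses are then free
    of square roots. *)
Lemma hadamard_conj_mx2 (a b c d : C) :
  hadamard C *m mx2 a b c d *m (hadamard C)^t* =
  mx2 ((a + b + c + d) / 2) ((a - b + c - d) / 2)
      ((a + b - c - d) / 2) ((a - b - c + d) / 2).
Proof.
have half : (sqrtC 2)^-1 * (sqrtC 2)^-1 = 2^-1 :> C.
  by rewrite -invfM -expr2 sqrtCK.
have real : ((sqrtC 2)^-1)^* = (sqrtC 2)^-1 :> C.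
  by apply: conj_Creal; rewrite rpredV ger0_real // sqrtC_ge0 ler0n.
rewrite /hadamard linearZ /= map_mxZ /= real.
rewrite -scalemxAl -scalemxAl -scalemxAr scalerA half.
rewrite mx2_adj !mx2_mul mx2_scale.
rewrite conjC1 rmorphN1 !mul1r !mulr1 !mulrN1 !mulN1r.
by congr mx2; ring.
Qed.

Lemma hadamard_unitary : hadamard C \is unitarymx.
Proof.
have n2 : 2 != 0 :> C by rewrite pnatr_eq0.
have := hadamard_conj_mx2 1 0 0 1; rewrite -mx2_id mulmx1 => eqH.
by apply/unitarymxP; rewrite eqH mx2_id; congr mx2; field.
Qed.

Lemma hadamard_conj x z :
  hadamard C *m pauli_of_bits C x z *m (hadamard C)^t*
  = (-1) ^+ ((x == 1) && (z == 1)) *: pauli_of_bits C z x.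
Proof.
have n2 : 2 != 0 :> C by rewrite pnatr_eq0.
have [->|->] := F2P x; have [->|->] := F2P z;
  by rewrite /pauli_of_bits /= hadamard_conj_mx2 mx2_scale; congr mx2; field.
Qed.

End LocalCliffords.

(** * Pauli commutation, and the Hadamard and phase stages *)

Section Stages.
Variable C : numClosedFieldType.

Lemma unitarymx_id n : 1%:M \is @unitarymx C n n.
Proof. by apply/unitarymxP; rewrite trmx1 map_mx1 mulmx1. Qed.

Lemma pauli_of_bits_unitary x z : pauli_of_bits C x z \is unitarymx.
Proof.
apply/unitarymxP; have [->|->] := F2P x; have [->|->] := F2P z;
  rewrite /pauli_of_bits /= mx2_adj mx2_mul mx2_id;
  by rewrite ?rmorphN /= ?conjC0 ?conjC1 ?conjCi; congr mx2; ring: (sqrCi C).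
Qed.

Lemma pauli_of_bits_comm x z x' z' :
  pauli_of_bits C x z *m pauli_of_bits C x' z' =
  (-1) ^+ (x * z' + z * x')%R *: (pauli_of_bits C x' z' *m pauli_of_bits C x z).
Proof.
have [->|->] := F2P x; have [->|->] := F2P z;
  have [->|->] := F2P x'; have [->|->] := F2P z';
  by rewrite /pauli_of_bits /= !mx2_mul mx2_scale; congr mx2; ring: (sqrCi C).
Qed.

Section PauliRow.
Variable n : nat.
Implicit Types x z : 'rV['F_2]_n.

Lemma pauli_row_unitary x z : pauli_row C x z \is unitarymx.
Proof. by apply: tensor_unitary => k; apply: pauli_of_bits_unitary. Qed.

Lemma pauli_row_comm x z x' z' :
  pauli_row C x z *m pauli_row C x' z' =
  (-1) ^+ ((x *m z'^T + z *m x'^T)%R 0 0)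
    *: (pauli_row C x' z' *m pauli_row C x z).
Proof.
rewrite !tensor_mul.
rewrite (eq_tensor (fun k => pauli_of_bits_comm _ _ _ _)) tensor_scale.
congr (_ *: _); rewrite prod_signr_F2 !mxE -big_split.
by congr ((-1) ^+ nat_of_ord _); apply: eq_bigr => k _; rewrite !mxE.
Qed.

(** If the symplectic form were 1, the operators would also anticommute, so their product would
    vanish although it is unitary. *)
Lemma commuting_pauli_row x z x' z' :
  pauli_row C x z *m pauli_row C x' z' = pauli_row C x' z' *m pauli_row C x z ->
  x *m z'^T + z *m x'^T = 0.
Proof.
rewrite pauli_row_comm => eqPQ; apply/rowP => i; rewrite !ord1 [RHS]mxE.
have [//|e1] := F2P ((x *m z'^T + z *m x'^T) 0 0).
pose Q := pauli_row C x' z' *m pauli_row C x z.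
have uQ : Q \is unitarymx by rewrite mul_unitarymx ?pauli_row_unitary.
have Q0 : Q = 0.
  apply/eqP; move: eqPQ; rewrite e1 expr1 scaleN1r -/Q => /eqP.
  rewrite eq_sym -addr_eq0 -mulr2n -scaler_nat scaler_eq0.
  by rewrite pnatr_eq0.
have := unitarymxP uQ; rewrite Q0 mul0mx => /matrixP.
(* The all-zero basis state provides a diagonal entry at which 0 and the identity differ. *)
pose y := enum_rank ([ffun=> 0] : basis n) => /(_ y y).
by rewrite !mxE eqxx => /esym/eqP; rewrite oner_eq0.
Qed.

Lemma H_stage (S : {set 'I_n}) : exists U : qop C n,
  [/\ is_H_stage U, U \is unitarymx & forall x z,
      conj_pauli U x z (swap_on S x z) (swap_on S z x)].
Proof.
exists (\big[mulmx/1%:M]_(a <- enum S) gate1 (hadamard C) a).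
split; first by exists (enum S).
  rewrite gate1_stage ?enum_uniq //; apply: tensor_unitary => k.
  by case: ifP => _; rewrite ?hadamard_unitary ?unitarymx_id.
move=> x z; rewrite gate1_stage ?enum_uniq //; apply: tensor_conj_pauli => k.
rewrite !mxE mem_enum; case: ifP => _; first by eexists; apply: hadamard_conj.
by exists false; rewrite trmx1 map_mx1 mulmx1 mul1mx scale1r.
Qed.

Lemma S_stage (d : 'rV['F_2]_n) : exists U : qop C n,
  [/\ is_S_stage U, U \is unitarymx & forall x z,
      conj_pauli U x z x (z + x *m diag_mx d)].
Proof.
pose s := [seq k <- enum 'I_n | d 0 k == 1].
have us : uniq s by rewrite filter_uniq ?enum_uniq.
exists (\big[mulmx/1%:M]_(a <- s) gate1 (phase C) a).
split; first by exists s.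
  rewrite gate1_stage //; apply: tensor_unitary => k.
  by case: ifP => _; rewrite ?phase_unitary ?unitarymx_id.
move=> x z; rewrite gate1_stage //; apply: tensor_conj_pauli => k.
rewrite mul_mx_diag !mxE mem_filter mem_enum andbT.
have [->|->] := F2P (d 0 k) => /=.
  by exists false; rewrite trmx1 map_mx1 mulmx1 mul1mx scale1r mulr0 addr0.
by rewrite mulr1; eexists; apply: phase_conj.
Qed.

(** * Pauli operators as phased translations of bit strings *)

Definition bits_row (w : basis n) : 'rV['F_2]_n := \row_k w k.

Lemma bits_row_inj : injective bits_row.
Proof.
by move=> y w /rowP yw; apply/ffunP => k; have := yw k; rewrite !mxE.
Qed.

(** The Weyl form: [x] translates the basis state, [z] contributes a character, and each [sigma_y]
    factor contributes one ['i]. The exponent of ['i] is a sum in [nat], since it matters modulo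
    4. *)
Lemma pauli_rowE x z :
  pauli_row C x z = qop_of (fun y w =>
    'i ^+ (\sum_k (x 0 k * z 0 k)%R)%N
    * (-1) ^+ ((z *m (bits_row w)^T)%R 0 0)
    * (bits_row y == bits_row w + x)%:R).
Proof.
apply: eq_qop_of => y w.
transitivity (\prod_k ('i ^+ (x 0 k * z 0 k)%R * (-1) ^+ (z 0 k * w k)%R
                       * (y k == w k + x 0 k)%:R : C)).
  apply: eq_bigr => k _; move: (y k) (w k) (x 0 k) (z 0 k) => u v a b.
  have [->|->] := F2P a; have [->|->] := F2P b;
  have [->|->] := F2P u; have [->|->] := F2P v;
  by rewrite /pauli_of_bits !mxE /=
    ?(expr0, expr1, mulr1, mul1r, mulr0, mulrN1).
rewrite !big_split prod_signr_F2 prodrXr /=; congr (_ * _ * _).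
  rewrite mxE; congr ((-1) ^+ nat_of_ord _).
  by apply: eq_bigr => k _; rewrite !mxE.
have -> : bits_row w + x = bits_row [ffun k => w k + x 0 k].
  by apply/rowP => k; rewrite !mxE ffunE.
rewrite (inj_eq bits_row_inj) -prod_eq_ffun.
by apply: eq_bigr => k _; rewrite ffunE.
Qed.
End PauliRow.

(** A CX gate may change the number of [sigma_y] factors but not its parity, so the phases before
    and after agree up to sign. *)
Lemma expCi_odd m m' : odd m = odd m' ->
  exists b : bool, 'i ^+ m = (-1) ^+ b * 'i ^+ m' :> C.
Proof.
move=> mm'; exists (odd (m./2 + m'./2)); rewrite signr_odd.
rewrite -[m in LHS]odd_double_half -{2}[m']odd_double_half mm' !exprD.
rewrite -!muln2 ![(_ * 2)%N]mulnC !exprM sqrCi.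
by rewrite mulrCA -mulrA -expr2 -exprM mulnC exprM sqrrN !expr1n mulr1 mulrC.
Qed.

(** * CX circuits as linear maps over ['F_2] *)

Section CXCircuits.
Variable n : nat.
Implicit Types x z : 'rV['F_2]_n.

Lemma mul_transvection (R : comNzRingType) (v : 'rV[R]_n) a b k :
  (v *m (1%:M + delta_mx a b)) 0 k = v 0 k + (k == b)%:R * v 0 a.
Proof.
rewrite mulmxDr mulmx1 mxE; congr (_ + _); rewrite mxE (bigD1 a) //= big1.
  by rewrite mxE eqxx addr0 mulrC.
by move=> j /negbTE ja; rewrite mxE ja mulr0.
Qed.

Lemma transvection_invol (a b : 'I_n) : a != b ->
  (1%:M + delta_mx a b) *m (1%:M + delta_mx a b) = 1%:M :> 'M['F_2]_n.
Proof.
move=> ab; rewrite mulmxDl mul1mx mulmxDr mulmx1 mul_delta_mx_0; last first.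
  by rewrite eq_sym.
have EE : delta_mx a b + delta_mx a b = 0 :> 'M['F_2]_n.
  by apply/eqP; rewrite addF2_eq0.
by rewrite addr0 -addrA EE addr0.
Qed.

Lemma bits_row_cx (a b : 'I_n) (w : basis n) :
  bits_row (cx_basis a b w) = bits_row w *m (1%:M + delta_mx a b).
Proof.
apply/rowP => k; rewrite mul_transvection !mxE ffunE.
by case: eqP => [->|_]; rewrite ?mul1r ?mul0r ?addr0 // addrC.
Qed.

Lemma cx_basis_invol (a b : 'I_n) : a != b -> involutive (cx_basis a b).
Proof.
move=> ab w; apply: bits_row_inj.
by rewrite !bits_row_cx -mulmxA transvection_invol // mulmx1.
Qed.

(** CX is the permutation matrix of an involution, so each of the two sums has a single nonzero
    term. *)
Lemma CX_conj_qop_of (a b : 'I_n) (f : basis n -> basis n -> C) : a != b ->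
  CX C a b *m qop_of f *m (CX C a b)^t* =
  qop_of (fun y w => f (cx_basis a b y) (cx_basis a b w)).
Proof.
move=> ab; have cxK := cx_basis_invol ab.
rewrite qop_of_adj !qop_of_mul; apply: eq_qop_of => y w.
rewrite (bigD1 (cx_basis a b w)) //= cxK eqxx rmorph1 mulr1.
rewrite [X in _ + X]big1 ?addr0 => [|v /negbTE vw]; last first.
  by rewrite [w == _]eq_sym (canF_eq cxK) vw rmorph0 mulr0.
rewrite (bigD1 (cx_basis a b y)) //= cxK eqxx mul1r.
rewrite big1 ?addr0 // => v /negbTE vy.
by rewrite [y == _]eq_sym (canF_eq cxK) vy mul0r.
Qed.

Lemma CX_unitary (a b : 'I_n) : a != b -> CX C a b \is unitarymx.
Proof.
move=> ab; apply/unitarymxP.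
have := CX_conj_qop_of (fun y w => (y == w)%:R) ab.
rewrite qop_of_id mulmx1 => ->; rewrite -qop_of_id; apply: eq_qop_of => y w.
by rewrite (inj_eq (inv_inj (cx_basis_invol ab))).
Qed.

(* The usual z -> z M^-T, with M^T moved to the input to avoid an inverse. *)
Definition acts_linearly (U : qop C n) (M : 'M['F_2]_n) :=
  U \is unitarymx /\ forall x z, conj_pauli U x (z *m M^T) (x *m M) z.

Lemma acts_linearly_id : acts_linearly 1%:M 1%:M.
Proof.
split=> [|x z]; first exact: unitarymx_id.
by exists false; rewrite !trmx1 map_mx1 !mulmx1 mul1mx scale1r.
Qed.

(** In [U *m V] the operator [V] acts first, so on row vectors its matrix [N] stands to the left of
    [M]. *)
Lemma acts_linearly_mul U V M N :
  acts_linearly U M -> acts_linearly V N -> acts_linearly (U *m V) (N *m M).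
Proof.
move=> [uU actU] [uV actV]; split=> [|x z]; first exact: mul_unitarymx.
rewrite trmx_mul !mulmxA; exact: conj_pauli_mul (actV _ _) (actU _ _).
Qed.

Lemma CX_acts (a b : 'I_n) : a != b ->
  acts_linearly (CX C a b) (1%:M + delta_mx a b).
Proof.
move=> ab; split=> [|x z]; first exact: CX_unitary.
set N := 1%:M + _; have NN : N *m N = 1%:M by apply: transvection_invol.
pose weight (x z : 'rV['F_2]_n) := (\sum_k (x 0 k * z 0 k)%R)%N.
have odd_weight (x1 z1 : 'rV['F_2]_n) :
    odd (weight x1 z1) = odd ((x1 *m z1^T)%R 0 0).
  rewrite /weight odd_sum_F2 mxE; congr (odd (nat_of_ord _)).
  by apply: eq_bigr => k _; rewrite !mxE.
(* Both weights have the parity of [x N z^T]. *)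
have [|c iE] := @expCi_odd (weight x (z *m N^T)) (weight (x *m N) z).
  by rewrite !odd_weight trmx_mul trmxK mulmxA.
exists c; rewrite !pauli_rowE CX_conj_qop_of // qop_of_scale.
apply: eq_qop_of => y w; rewrite -!/(weight _ _) iE !mulrA; congr (_ * _ * _).
  (* The characters agree because the two transposed copies of [N] cancel. *)
  by rewrite bits_row_cx trmx_mul !mulmxA -(mulmxA z) -trmx_mul NN trmx1 mulmx1.
have injN : injective (fun v : 'rV_n => v *m N).
  by move=> u v /(congr1 (fun v => v *m N)); rewrite -!mulmxA NN !mulmx1.
by rewrite !bits_row_cx -(inj_eq injN) mulmxDl -!mulmxA NN !mulmx1.
Qed.

(** Each nonzero entry below the diagonal becomes one CX gate. In a suitable order, the product of
    the corresponding transvections is the identity plus the sum of their off-diagonal parts, which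
    is [L]. *)
Lemma linear_stage (L : 'M['F_2]_n) :
  is_trig_mx L -> (forall i, L i i = 1) ->
  exists U : qop C n, is_CX_stage (n ^ 2) U /\ acts_linearly U L.
Proof.
move=> /is_trig_mxP trigL diagL.
pose below (p : 'I_n * 'I_n) := (p.2 < p.1)%N && (L p.1 p.2 == 1).
(* With row indices decreasing along [s], the cross terms
   delta_(q.1,q.2) delta_(p.1,p.2), for p before q, all vanish. *)
pose leT := relpre (fun p : 'I_n * 'I_n => val p.1) geq.
pose s := [seq p <- sort leT (enum {: 'I_n * 'I_n}) | below p].
have transT : transitive leT.
  by move=> q p r /= qp rq; apply: leq_trans rq qp.
have totT : total leT by move=> p q; apply: leq_total.
have below_s : all below s by apply: filter_all.
have sorted_s : pairwise leT s.
  by rewrite -sorted_pairwise // sorted_filter // sort_sorted.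
exists (\big[mulmx/1%:M]_(p <- s) CX C p.1 p.2); split.
  exists s; split=> //.
    apply: sub_all below_s => p /andP[lt_p _].
    by apply: contraTneq lt_p => ->; rewrite ltnn.
  rewrite size_filter (leq_trans (count_size _ _)) // size_sort -cardE.
  by rewrite card_prod card_ord.
have -> : L = 1%:M + \sum_(p <- s) delta_mx p.1 p.2.
  apply/matrixP => i j; rewrite big_filter mxE summxE.
  rewrite (perm_big (enum {: 'I_n * 'I_n})) /=; last by rewrite perm_sort.
  rewrite big_enum_cond /= big_mkcond (bigD1 (i, j)) //= big1 ?addr0.
    rewrite /below !mxE /=; case: ltngtP => [ji|ij|/val_inj->].
    - rewrite -val_eqE gtn_eqF //.
      by have [->|->] := F2P (L i j); rewrite /= ?mxE ?eqxx add0r.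
    - by rewrite -val_eqE ltn_eqF // trigL // addr0.
    - by rewrite diagL eqxx addr0.
  move=> [k l] kl; case: ifP => // _.
  by rewrite mxE -xpair_eqE eq_sym (negbTE kl).
elim: s below_s sorted_s => [|p s IHs] /=.
  by rewrite !big_nil addr0 => _ _; apply: acts_linearly_id.
case/andP=> /andP[lt_p _] below_s /andP[p_s sorted_s]; rewrite !big_cons.
have pN : p.1 != p.2 by apply: contraTneq lt_p => ->; rewrite ltnn.
(* The gate of [p] is applied last, so its transvection is the right factor; the cross terms vanish
   because [q.2 < q.1 <= p.1]. *)
have -> : 1%:M + (delta_mx p.1 p.2 + \sum_(q <- s) delta_mx q.1 q.2)
  = (1%:M + \sum_(q <- s) delta_mx q.1 q.2) *m (1%:M + delta_mx p.1 p.2)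
  :> 'M['F_2]_n.
  have sp0 : (\sum_(q <- s) delta_mx q.1 q.2) *m delta_mx p.1 p.2 = 0
    :> 'M['F_2]_n; last first.
    by rewrite mulmxDr mulmx1 mulmxDl mul1mx sp0 addr0 addrA addrAC.
  rewrite mulmx_suml big_seq big1 // => q qs; rewrite mul_delta_mx_0 //.
  have /andP[lt_q _] := allP below_s q qs; have := allP p_s q qs => /= le_qp.
  by rewrite -val_eqE neq_ltn (leq_trans lt_q le_qp).
exact: acts_linearly_mul (CX_acts pN) (IHs below_s sorted_s).
Qed.
End CXCircuits.

End Stages.

(** * From the tableau to the five-stage circuit *)

Lemma is_tableau_row (C : numClosedFieldType) m n (P : 'I_m -> qop C n)
    X Z r i :
  is_tableau P X Z r -> P i = (-1) ^+ r i *: pauli_row C (row i X) (row i Z).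
Proof.
move=> tabP; rewrite tabP; congr (_ *: _); apply: eq_tensor => k.
by rewrite !mxE.
Qed.

Lemma commuting_tableau (C : numClosedFieldType) m n (P : 'I_m -> qop C n)
    X Z r :
  is_tableau P X Z r -> (forall i j, P i *m P j = P j *m P i) ->
  X *m Z^T + Z *m X^T = 0.
Proof.
move=> tabP commP; apply/matrixP => i j; rewrite [RHS]mxE.
have := commP i j; rewrite !(is_tableau_row _ tabP).
rewrite -!scalemxAl -!scalemxAr !scalerA [X in X *: _ = _]mulrC.
move/(scalerI _) => /(_ _)/commuting_pauli_row H.
have /H/rowP/(_ 0) : (-1) ^+ r j * (-1) ^+ r i != 0 :> C.
  by rewrite mulf_neq0 ?signr_eq0.
rewrite [RHS]mxE => <-; rewrite !mxE.
by congr (_ + _); apply: eq_bigr => k _; rewrite !mxE.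
Qed.

Lemma signed_tensor_pauli_z (C : numClosedFieldType) n (z : 'rV['F_2]_n)
    (b : bool) :
  signed_tensor_of [:: sigma_i C; sigma_z C] ((-1) ^+ b *: pauli_row C 0 z).
Proof.
exists b, (fun k => pauli_of_bits C 0 (z 0 k)); split=> [k|].
  by rewrite /pauli_of_bits /=; case: ifP => _; rewrite !inE eqxx ?orbT.
by congr (_ *: _); apply: eq_tensor => k; rewrite mxE.
Qed.

(** Distinct basis states differ at some qubit, where the tensor factor has a zero off-diagonal
    entry. *)
Lemma signed_pauli_z_diag (C : numClosedFieldType) n (M : qop C n) :
  signed_tensor_of [:: sigma_i C; sigma_z C] M -> is_diag_mx M.
Proof.
case=> b [A [A_iz ->]]; apply/is_diag_mxP => i j neq_ij; rewrite !mxE.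
have /neq_ffun[k neq_k] : enum_val i != enum_val j.
  by rewrite (inj_eq enum_val_inj).
rewrite (bigD1 k) //=; move: (enum_val i k) (enum_val j k) neq_k => u v neq_uv.
suff -> : A k u v = 0 by rewrite mul0r mulr0.
have := A_iz k; rewrite !inE => /orP[]/eqP->; rewrite mxE;
  by have [uE|uE] := F2P u; have [vE|vE] := F2P v; move: neq_uv; rewrite uE vE.
Qed.

Theorem theorem4p4 :
  exists K : nat, (0 < K)%N /\
    forall (C : numClosedFieldType) (n m : nat) (P : 'I_m -> qop C n)
           (X Z : 'M['F_2]_(m, n)) (r : 'I_m -> bool),
      (1 <= n)%N ->
      (forall i, is_pauli (P i)) ->
      (forall i j, P i *m P j = P j *m P i) ->
      is_tableau P X Z r ->
      \rank (row_mx X Z) = n ->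
      exists U1 U2 U3 U4 U5 : qop C n,
        [/\ is_H_stage U1, is_S_stage U2, is_CX_stage (K * n ^ 2) U3,
            is_S_stage U4 & is_H_stage U5] /\
        let U : qop C n := U5 *m U4 *m U3 *m U2 *m U1 in
        U \is unitarymx /\
        forall j, signed_tensor_of [:: sigma_i C; sigma_z C] (U *m P j *m U^t*) /\
                  is_diag_mx (U *m P j *m U^t*).
Proof.
(* The constant is 1, as [linear_stage] uses at most [n ^ 2] gates. *)
exists 1%N; split=> // C n m P X Z r _ _ commP tabP rankXZ.
have isoXZ := commuting_tableau tabP commP.
have [S [A [symA Z1E]]] := lagrangian_graph isoXZ rankXZ.
have [d [L [trigL diagL gramL]]] := unitriangular_gram_add_diag symA.
have [U1 [stage1 unitary1 conj1]] := H_stage C S.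
have [U2 [stage2 unitary2 conj2]] := S_stage C d.
have [U3 [stage3 [unitary3 conj3]]] := linear_stage C trigL diagL.
have [U4 [stage4 unitary4 conj4]] := S_stage C (const_mx 1 : 'rV_n).
have [U5 [stage5 unitary5 conj5]] := H_stage C (setT : {set 'I_n}).
exists U1, U2, U3, U4, U5; split; first by rewrite mul1n.
move=> U; split; first by rewrite !mul_unitarymx.
suff signedU j : signed_tensor_of [:: sigma_i C; sigma_z C] (U *m P j *m U^t*).
  by move=> j; split; [|apply: signed_pauli_z_diag]; apply: signedU.
pose x := row j (swap_on S X Z).
have [b eqU] : conj_pauli U (row j X) (row j Z) 0 (x *m L).
  apply: conj_pauli_mul (conj1 _ _) _.
  rewrite -!row_swap_on -/x Z1E row_mul -/x.
  (* The phase gates turn [(x, x A)] into [(x, (x L) L^T)], the input form required by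
     [acts_linearly]. *)
  apply: conj_pauli_mul (conj2 _ _) _; rewrite -mulmxDr gramL mulmxA.
  apply: conj_pauli_mul (conj3 _ _) _.
  apply: conj_pauli_mul (conj4 _ _) _.
  (* A phase gate on every qubit adds [x L] to itself, which gives 0 over ['F_2]. *)
  rewrite diag_const_mx mulmx1 (_ : x *m L + x *m L = 0); last first.
    by apply/eqP; rewrite addF2_eq0.
  have := conj5 (x *m L) 0; congr (conj_pauli _ _ _ _ _);
    by apply/rowP => k; rewrite !mxE inE.
rewrite (is_tableau_row _ tabP) -scalemxAr -scalemxAl eqU scalerA -signr_addb.
exact: signed_tensor_pauli_z.
Qed.
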